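(* Let $\alpha\in[0,1]$ and let $b_1,b_2,\ldots$ and $c_1,c_2,\ldots$ be the (finite or infinite) sequences produced by Shulga's algorithm applied to $\alpha$. Then for every $n>1$ for which $b_n$ and $c_n$ are defined, one has $c_n>b_n$.
   Context: Continued fractions: $[a_0;a_1,a_2,\ldots]=a_0+\cfrac{1}{a_1+\cfrac{1}{a_2+\cdots}}$ with $a_0\in\mathbb{Z}$ and positive integers $a_i$ ($i\ge1$). For rational numbers one uses the finite expansion whose last partial quotient is greater than $1$, except that for the number $1$ one uses $1=[0;1]$, i.e. $a_1(1)=1$. $a_n(x)$ denotes the $n$th partial quotient of $x$ (undefined if $n$ exceeds the length of the expansion). An empty list of partial quotients gives $[0;\,]=0$. Shulga's algorithm for $\alpha\in[0,1]$: for $n=0,1,2,\ldots$, suppose $b_k,c_k$ are defined for $1\le k\le n$. If $\alpha=[0;b_1,\ldots,b_n]+[0;c_1,\ldots,c_n]$, put $\beta=[0;b_1,\ldots,b_n]$, $\gamma=[0;c_1,\ldots,c_n]$ and stop. Otherwise define $$b_{n+1}=a_{n+1}(\alpha-[0;c_1,\ldots,c_n])+1,\qquad c_{n+1}=a_{n+1}(\alpha-[0;b_1,\ldots,b_n,b_{n+1}]).$$ If the algorithm never stops, put $\beta=[0;b_1,b_2,\ldots]$, $\gamma=[0;c_1,c_2,\ldots]$. It is known (Shulga) that these quantities are always well defined and that $\alpha=\beta+\gamma$; this is called the Shulga decomposition of $\alpha$. *)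

(* Defs.v *)
(* MathComp world, real numbers from MathComp-Analysis. *)
From mathcomp Require Import all_boot all_order all_algebra.
From mathcomp Require Import reals.

Set Implicit Arguments.
Unset Strict Implicit.
Unset Printing Implicit Defensive.

Import Order.TTheory GRing.Theory Num.Theory.
Local Open Scope ring_scope.

(* [0; s_1, ..., s_k]; the empty expansion has value 0. *)
Definition cf_value (R : realType) (s : seq int) : R :=
  foldr (fun (a : int) (r : R) => (a%:~R + r)^-1) 0 s.

(* a_0(x). The number 1 is expanded as [0; 1]. *)
Definition partial_quotient0 (R : realType) (x : R) : int :=
  if x == 1 then 0 else Num.floor x.

(* The tails t_n of the expansion of x: t_0 = x - a_0 and
   1 / t_n = a_{n+1} + t_{n+1}. The expansion has length n exactly when t_n is
   the first tail equal to 0; since 0^-1 = 0, all later tails are then 0. *)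
Fixpoint cf_tail (R : realType) (n : nat) (x : R) : R :=
  if n is m.+1 then (cf_tail m x)^-1 - (Num.floor (cf_tail m x)^-1)%:~R
  else x - (partial_quotient0 x)%:~R.

(* a_n(x), or None if n exceeds the length of the expansion of x. *)
Definition partial_quotient (R : realType) (n : nat) (x : R) : option int :=
  if n is m.+1 then
    if cf_tail m x == 0 then None else Some (Num.floor (cf_tail m x)^-1)
  else Some (partial_quotient0 x).

Lemma cf_tail_step (R : realType) (n : nat) (x : R) (a : int) :
  partial_quotient n.+1 x = Some a ->
  cf_tail n x = (a%:~R + cf_tail n.+1 x)^-1.
Proof. by rewrite /=; case: eqP => // _ [<-]; rewrite addrC subrK invrK. Qed.

Lemma cf_tail_ge0 (R : realType) (n : nat) (x : R) : 0 <= cf_tail n x.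
Proof.
case: n => [|n] /=; last by rewrite subr_ge0 floor_le.
rewrite /partial_quotient0 subr_ge0; case: eqP => [->|_]; first exact: ler01.
exact: floor_le.
Qed.

Lemma cf_tail_lt1 (R : realType) (n : nat) (x : R) :
  x != 1 -> cf_tail n x < 1.
Proof.
move=> x1; case: n => [|n] /=; last by rewrite ltrBlDl -(intrD R _ 1) floorD1_gt.
by rewrite /partial_quotient0 (negbTE x1) ltrBlDl -(intrD R _ 1) floorD1_gt.
Qed.

(* The last partial quotient of a finite expansion exceeds 1, except for 1. *)
Lemma last_partial_quotient_gt1 (R : realType) (n : nat) (x : R) (a : int) :
  x != 1 -> partial_quotient n.+1 x = Some a -> cf_tail n.+1 x = 0 -> 1 < a.
Proof.
move=> x1 Ha t0; have := cf_tail_lt1 n x1; have := cf_tail_ge0 n x.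
have: cf_tail n x != 0 by move: Ha => /=; case: eqP.
rewrite (cf_tail_step Ha) t0 addr0 => an0 a0 a1.
rewrite -(ltr1z R) -invf_lt1 // -invr_gt0 lt_def an0 a0 //.
Qed.

Lemma partial_quotient1 (R : realType) : partial_quotient 1 (1 : R) = Some 1.
Proof. by rewrite /= /partial_quotient0 eqxx subr0 oner_eq0 invr1 floor1. Qed.

(* One round of the algorithm, from (b_1..b_n, c_1..c_n) to
   (b_1..b_{n+1}, c_1..c_{n+1}); None if the algorithm stops. None is also
   returned if a required partial quotient does not exist, which is known not
   to occur when 0 <= alpha <= 1. *)
Definition shulga_step (R : realType) (alpha : R) (bc : seq int * seq int) :
    option (seq int * seq int) :=
  let: (b, c) := bc in
  let n := size b in
  if alpha == cf_value R b + cf_value R c then None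
  else if partial_quotient n.+1 (alpha - cf_value R c) is Some a then
    let b' := rcons b (a + 1) in
    if partial_quotient n.+1 (alpha - cf_value R b') is Some a' then
      Some (b', rcons c a')
    else None
  else None.

(* (b_1..b_n, c_1..c_n), or None if the algorithm stops before round n. *)
Definition shulga_state (R : realType) (alpha : R) (n : nat) :
    option (seq int * seq int) :=
  iter n (obind (shulga_step alpha)) (Some ([::], [::])).

(* b_n and c_n (n >= 1), or None if undefined; onth counts from 0. *)
Definition shulga_b (R : realType) (alpha : R) (n : nat) : option int :=
  obind (fun bc => onth bc.1 n.-1) (shulga_state alpha n).

Definition shulga_c (R : realType) (alpha : R) (n : nat) : option int :=
  obind (fun bc => onth bc.2 n.-1) (shulga_state alpha n).

(* Main.v *)
Require Import Defs.
From mathcomp Require Import all_boot all_order all_algebra.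
From mathcomp Require Import reals.
From mathcomp Require Import ring lra.
Import Order.TTheory GRing.Theory Num.Theory.
Local Open Scope ring_scope.

(** After n rounds, let beta = [0; b_1, ..., b_n] and gamma = [0; c_1, ..., c_n],
    and let q, q' (resp. s, s') be the denominators of beta (resp. gamma) and
    of its previous convergent. As long as the algorithm has not stopped,
    alpha - gamma = [0; b_1, ..., b_n, t] with a real t, and the algorithm picks
    a = floor t + 1 for b_{n+1}. Then
    alpha - [0; b_1, ..., b_n, a] = [0; c_1, ..., c_n, T] with a real T, and
    c_{n+1} = floor T. The same nonzero number
    alpha - [0; b_1, ..., b_n, a] - gamma
    is the error of a convergent on the b side and on the c side. Computing it
    both ways (cf_ext_rcons_offset and cf_ext_offset) gives
      s (s T + s') = Q W / e,  W = q t + q',  e = a - t,  Q = q a + q' = W + q e.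
    The claim for index n + 1 is thus T >= a + 1, an inequality between real
    numbers. It rests on two facts about the preceding round (n > 0), both
    obtained by comparing denominators:
    - alpha - beta lies strictly between gamma and [0; c_1, ..., c_n + 1], so
      the error 1 / (q W) is less than 1 / (s (s + s'));
    - alpha - [0; c_1, ..., c_{n-1}] lies between beta and
      [0; b_1, ..., b_n - 1], while its distance to beta exceeds
      1 / (s' (s + s')), so q (q - q') <= s' (s + s').
    next_quotient_large derives T >= a + 1 from these two inequalities, and
    shulga_round shows that they hold again after the round. Together
    with the comparisons q <= s and q' <= s', which follow from b_k <= c_k, the
    first fact ensures t > 1, so that the partial quotients read off by the
    algorithm are those of the displayed expansions. *)

(** * Expansions with a real tail *)

(** The value of [0; s_1, ..., s_k + y]. Having the real tail y added to the last
    quotient, rather than 1 / y appended, makes the finite expansion the case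
    y = 0. *)
Definition cf_ext {R : realType} (s : seq int) (y : R) : R :=
  foldr (fun (a : int) (r : R) => (a%:~R + r)^-1) y s.

Lemma cf_ext0 {R : realType} (s : seq int) : cf_ext s 0 = cf_value R s.
Proof. by []. Qed.

Lemma cf_ext_rcons {R : realType} (s : seq int) (a : int) (y : R) :
  cf_ext (rcons s a) y = cf_ext s (a%:~R + y)^-1.
Proof. by rewrite /cf_ext foldr_rcons. Qed.

(** The denominators of the last two convergents of [0; s_1, ..., s_k]; for the
    empty expansion they are 1 and 0. *)
Definition denoms {R : realType} (s : seq int) : R * R :=
  foldl (fun (q : R * R) (a : int) => (q.1 * a%:~R + q.2, q.1)) (1, 0) s.

Lemma denoms_rcons {R : realType} (s : seq int) (a : int) :
  denoms (rcons s a) = ((denoms s).1 * a%:~R + (denoms s).2, (denoms s).1) :> R * R.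
Proof. by rewrite /denoms -cats1 foldl_cat. Qed.

Definition positive_quotients (s : seq int) : bool := all (fun a => 1 <= a) s.

Lemma denoms_ge {R : realType} (s : seq int) :
  positive_quotients s -> 1 <= (denoms s : R * R).1 /\ 0 <= (denoms s : R * R).2.
Proof.
elim/last_ind: s => [|s a IH]; first by rewrite /= lexx.
rewrite /positive_quotients all_rcons denoms_rcons => /andP[a1 /IH[q1 q2]] /=.
have : 1 <= a%:~R :> R by rewrite ler1z.
by nra.
Qed.

(** The map y |-> [0; s_1, ..., s_k + y] is a Moebius transformation of
    determinant +1 or -1 with denominator q + q' y. *)
Lemma cf_ext_sub {R : realType} (s : seq int) (y z : R) :
  positive_quotients s -> 0 <= y -> 0 <= z ->
  cf_ext s y - cf_ext s z =
  (-1) ^+ size s * ((y - z) / (((denoms s).1 + (denoms s).2 * y) *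
                               ((denoms s).1 + (denoms s).2 * z))).
Proof.
elim/last_ind: s y z => [|s a IH] y z.
  by move=> _ _ _; rewrite /= expr0; field.
rewrite /positive_quotients all_rcons => /andP[a1 sP] y0 z0.
have {}a1 : 1 <= a%:~R :> R by rewrite ler1z.
have [q1 q2] := denoms_ge (R := R) _ sP.
rewrite !cf_ext_rcons IH ?invr_ge0 //; [|lra|lra].
rewrite denoms_rcons size_rcons exprS /=.
move: (denoms s).1 (denoms s).2 q1 q2 => q q' q1 q2.
move: ((-1) ^+ size s) => e; field.
by rewrite !lt0r_neq0 //=; nra.
Qed.

(** * Reading off partial quotients *)

Lemma floor_addz {R : realType} (a : int) (y : R) :
  0 <= y < 1 -> Num.floor (a%:~R + y) = a.
Proof.
move=> /andP[y0 y1]; apply: floor_def; rewrite intrD mulr1z.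
by apply/andP; split; lra.
Qed.

Lemma cf_tail0 {R : realType} (y : R) : 0 < y <= 1 -> cf_tail 0 y = y.
Proof.
move=> /andP[y0 y1]; rewrite /= /partial_quotient0; case: eqP => [_|/eqP ne].
  by rewrite subr0.
have -> : Num.floor y = 0; last by rewrite subr0.
by apply: floor_def; rewrite add0r /= (ltW y0) lt_neqAle ne.
Qed.

(** Strict positivity of y keeps every intermediate tail below 1 even after a
    quotient equal to 1, so that each floor returns the expected quotient. *)
Lemma cf_tail_ext {R : realType} (s : seq int) (y : R) :
  positive_quotients s -> 0 < y < 1 -> cf_tail (size s) (cf_ext s y) = y.
Proof.
elim/last_ind: s y => [|s a IH] y.
  by move=> _ /andP[y0 y1]; rewrite cf_tail0 // y0 ltW.
rewrite /positive_quotients all_rcons => /andP[a1 sP] /andP[y0 y1].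
have {}a1 : 1 <= a%:~R :> R by rewrite ler1z.
have ay : 1 < a%:~R + y by lra.
rewrite size_rcons cf_ext_rcons /= IH //; last first.
  by rewrite invr_gt0 invf_lt1; lra.
rewrite invrK floor_addz; last by lra.
by rewrite addrC addKr.
Qed.

(** The value t = 1 occurs only in the first round for alpha = 1, where it agrees
    with the convention 1 = [0; 1]. *)
Lemma partial_quotient_ext {R : realType} (s : seq int) (t : R) :
  positive_quotients s -> 1 <= t -> (s = [::] \/ 1 < t) ->
  partial_quotient (size s).+1 (cf_ext s t^-1) = Some (Num.floor t).
Proof.
move=> sP t1 st.
have t0 : 0 < t by lra.
have E : cf_tail (size s) (cf_ext s t^-1) = t^-1.
  case: st => [->|t1']; first by rewrite cf_tail0 // invr_gt0 t0 invf_le1.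
  by rewrite cf_tail_ext // invr_gt0 t0 invf_lt1.
by rewrite [LHS]/= E invr_eq0 gt_eqF // invrK.
Qed.

(** * The inequality *)

(** With W = q t + q' and Q = W + q e, the right-hand side is W^2 / e + q W. The
    first inequality absorbs s (s + s') into q W, leaving
    e s^2 (t + e) <= W^2. Multiplied by q, this is
    s (e s (W - q' + q e)) <= q W^2, where q W may be replaced by s (s + s');
    as e <= 1, it remains that s (q - q') <= s' W, which is the second
    inequality combined once more with the first. *)
Lemma next_quotient_large {R : realType} (q q' s s' t e : R) :
  0 < q -> 0 <= q' -> 0 < s -> 0 <= s' -> 0 < t -> 0 < e <= 1 ->
  s * (s + s') < q * (q * t + q') -> q * (q - q') <= s' * (s + s') ->
  s * (s * (t + e + 1) + s') <=
    (q * t + q' + q * e) * (q * t + q') / e.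
Proof.
move=> q0 q'0 s0 s'0 t0 /andP[e0 e1].
set W := q * t + q' => i ii.
have W0 : 0 < W by rewrite /W; nra.
have sW : s * (q - q') <= s' * W.
  rewrite -(ler_pM2l q0); nra.
have key : e * s ^+ 2 * (t + e) <= W ^+ 2.
  rewrite -(ler_pM2l q0).
  have H1 : e * (W - q' + q * e) <= W - q' + q.
    have X0 : 0 <= q * (t + e) by rewrite mulr_ge0 //; lra.
    have qe : q * e <= q by rewrite ger_pMr.
    have eX : e * (q * (t + e)) <= q * (t + e) by rewrite ler_piMl.
    by rewrite /W; lra.
  have H2 : s * (e * (W - q' + q * e)) <= (s + s') * W.
    apply: le_trans (_ : s * (W - q' + q) <= _); first by rewrite ler_pM2l.
    have -> : s * (W - q' + q) = s * W + s * (q - q') by ring.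
    by rewrite mulrDl lerD2l.
  have H3 : s * (s * (e * (W - q' + q * e))) <= s * ((s + s') * W).
    by rewrite ler_pM2l.
  have H4 : s * (s + s') * W <= q * W * W by rewrite ler_pM2r // ltW.
  have -> : q * (e * s ^+ 2 * (t + e)) = s * (s * (e * (W - q' + q * e))).
    by rewrite /W; ring.
  by apply: le_trans H3 _; rewrite mulrA; apply: le_trans H4 _; rewrite -mulrA -expr2.
rewrite ler_pdivlMr //; nra.
Qed.

(** * Distance to a convergent *)

(** The case y = 1 / t, z = 0 of the difference formula. Read from right to left,
    it recognizes a number at signed distance (-1)^k d from [0; s_1, ..., s_k] as
    [0; s_1, ..., s_k, t], where 1 / d = q (q t + q'). *)
Lemma cf_ext_offset {R : realType} (s : seq int) (t : R) :
  positive_quotients s -> 0 < t ->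
  cf_ext s t^-1 = cf_value R s +
    (-1) ^+ size s / ((denoms s).1 * ((denoms s).1 * t + (denoms s).2)).
Proof.
move=> sP t0; have [q1 q2] := denoms_ge (R := R) _ sP.
apply/eqP; rewrite addrC -subr_eq -cf_ext0 cf_ext_sub ?invr_ge0 ?(ltW t0) //.
apply/eqP; congr (_ * _).
move: (denoms s).1 (denoms s).2 q1 q2 => q q' q1 q2; field.
by rewrite !lt0r_neq0 //; nra.
Qed.

(** The sign tells which expansion the error can continue. If a > t, the new
    convergent overshoots and the error keeps the sign (-1)^k of an expansion
    continuing k quotients: this is how b_{n+1} leaves room for c_{n+1}. If
    a < t, the sign is that of an expansion continuing k + 1 quotients: this is
    how c_{n+1} leaves room for b_{n+2}. *)
Lemma cf_ext_rcons_offset {R : realType} (s : seq int) (a : int) (t : R) :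
  positive_quotients s -> 1 <= a -> 0 < t ->
  cf_ext s t^-1 = cf_value R (rcons s a) + (-1) ^+ size s * ((a%:~R - t) /
    ((denoms (rcons s a)).1 * ((denoms s).1 * t + (denoms s).2))).
Proof.
move=> sP a1 t0; have [q1 q2] := denoms_ge (R := R) _ sP.
have {}a1 : 1 <= a%:~R :> R by rewrite ler1z.
apply/eqP; rewrite addrC -subr_eq -cf_ext0 cf_ext_rcons addr0.
rewrite cf_ext_sub ?invr_ge0 ?(ltW t0) //; last by lra.
rewrite denoms_rcons /=; apply/eqP; congr (_ * _).
move: (denoms s).1 (denoms s).2 q1 q2 => q q' q1 q2; field.
by rewrite !lt0r_neq0 //; nra.
Qed.

(** * One round *)

(** Two errors of the preceding round. The reciprocal of the current error
    |alpha - beta - gamma| is q (q t + q'), while 1 / (s (s + s')) is the distance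
    from gamma to [0; c_1, ..., c_n + 1]. Likewise 1 / (q (q - q')) is the
    distance from beta to [0; b_1, ..., b_n - 1]; it is at least the error
    |alpha - beta - [0; c_1, ..., c_{n-1}]|, which exceeds 1 / (s' (s + s')). *)
Definition remainder_bounds {R : realType} (b c : seq int) (t : R) : Prop :=
  let: (q, q') := denoms b in let: (s, s') := denoms c in
  s * (s + s') < q * (q * t + q') /\ q * (q - q') <= s' * (s + s').

(** t is the complete quotient that the next b is read from. The
    bounds on it compare it with a preceding round, whence the exception for
    empty b. *)
Definition shulga_invariant {R : realType} (alpha : R) (b c : seq int) : Prop :=
  [/\ size b = size c, positive_quotients b, positive_quotients c,
      (denoms b : R * R).1 <= (denoms c).1 /\ (denoms b : R * R).2 <= (denoms c).2 &
      alpha != cf_value R b + cf_value R c ->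
      exists2 t, 1 <= t /\ alpha = cf_value R c + cf_ext b t^-1 &
                 b = [::] \/ remainder_bounds b c t].

Lemma shulga_invariant0 {R : realType} (alpha : R) :
  0 <= alpha <= 1 -> shulga_invariant alpha [::] [::].
Proof.
move=> /andP[a0 a1]; split=> //=; rewrite addr0 => ne.
have {}a0 : 0 < alpha by rewrite lt_neqAle eq_sym ne.
by exists alpha^-1; [rewrite invf_ge1 // invrK add0r | left].
Qed.

(** T is obtained by equating the error of the new b-convergent with
    1 / (s (s T + s')). Exchanging the roles of the two sequences, the
    fractional part of T gives the complete quotient t' of the next round,
    and T < floor T + 1 gives the bounds on t'. *)
Lemma shulga_round {R : realType} (alpha t : R) (b c : seq int) :
  size b = size c -> positive_quotients b -> positive_quotients c ->
  (denoms b : R * R).1 <= (denoms c).1 -> (denoms b : R * R).2 <= (denoms c).2 ->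
  1 <= t -> alpha = cf_value R c + cf_ext b t^-1 ->
  b = [::] \/ remainder_bounds b c t ->
  let a := Num.floor t + 1 in
  exists2 T : R,
    [/\ alpha = cf_value R (rcons b a) + cf_ext c T^-1,
        1 < T & b <> [::] -> a%:~R + 1 <= T] &
    shulga_invariant alpha (rcons b a) (rcons c (Num.floor T)).
Proof.
move=> sz bP cP qs qs' t1 alphaE red a.
have [q1 q'0] := denoms_ge (R := R) _ bP; have [s1 s'0] := denoms_ge (R := R) _ cP.
have t0 : 0 < t by lra.
have at_ : t < a%:~R <= t + 1.
  by rewrite floorD1_gt /a intrD mulr1z lerD2r floor_le.
have a2 : 2 <= a%:~R :> R.
  by rewrite /a intrD mulr1z -[2]/(1 + 1) lerD2r ler1z floor_ge_int.
have a1 : 1 <= a by rewrite -(ler1z R); lra.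
set q := (denoms b).1 in q1 qs; set q' := (denoms b).2 in q'0 qs'.
set s := (denoms c).1 in s1 qs; set s' := (denoms c).2 in s'0 qs'.
pose e := a%:~R - t; pose W := q * t + q'; pose Q := q * a%:~R + q'.
have QE : Q = W + q * e by rewrite /Q /W /e; ring.
have e01 : 0 < e <= 1 by rewrite /e; lra.
have e0 : 0 < e by lra.
have W0 : 0 < W by rewrite /W; nra.
have Q0 : 0 < Q by rewrite QE; nra.
pose T := (Q * W / e / s - s') / s.
have s0 : 0 < s by lra.
have TE : s * (s * T + s') = Q * W / e by rewrite /T; field; rewrite !lt0r_neq0.
have aT : a%:~R <= T /\ (b <> [::] -> a%:~R + 1 <= T).
  (* In the first round T = a t / e, which gives no more than T >= a. *)
  case: red => [b0|].
    have c0 : c = [::] by apply/size0nil; rewrite -sz b0.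
    split=> //; move: TE; rewrite /Q /W /q /q' /s /s' b0 c0 /=.
    rewrite !mul1r !addr0 => ->.
    by rewrite ler_pdivlMr //; nra.
  rewrite /remainder_bounds.
  rewrite (surjective_pairing (denoms b)) (surjective_pairing (denoms c)).
  rewrite -/q -/q' -/s -/s' => -[i ii].
  have q0 : 0 < q by lra.
  have := next_quotient_large q q' s s' t e q0 q'0 s0 s'0 t0 e01 i ii.
  rewrite -/W -QE -TE ler_pM2l // lerD2r ler_pM2l // /e => H.
  by split=> [|_]; lra.
case: aT => aT aT'.
have T1 : 1 < T by lra.
have T0 : 0 < T by lra.
have alphaE' : alpha = cf_value R (rcons b a) + cf_ext c T^-1.
  rewrite alphaE (cf_ext_rcons_offset b a t) // (cf_ext_offset c T) //.
  rewrite -/s -/s' TE denoms_rcons /= -/q -/q' -/Q -/W -/e sz.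
  by field; rewrite !lt0r_neq0.
exists T; first by split.
have ac : a <= Num.floor T by rewrite floor_ge_int.
have {ac} : a%:~R <= (Num.floor T)%:~R :> R by rewrite ler_int.
have : (Num.floor T)%:~R <= T < (Num.floor T)%:~R + 1.
  by rewrite floor_le -[X in _ + X](mulr1z 1) -intrD floorD1_gt.
move: (Num.floor T) => d /andP[dT Td] ad.
have d1 : 1 <= d by rewrite -(ler1z R); lra.
have bP' : positive_quotients (rcons b a) by rewrite /positive_quotients all_rcons a1.
have cP' : positive_quotients (rcons c d) by rewrite /positive_quotients all_rcons d1.
split=> //; first by rewrite !size_rcons sz.
  rewrite !denoms_rcons /= -/q -/q' -/s -/s'; split=> //; nra.
rewrite alphaE' => ne.
(* The algorithm goes on exactly when T has a nonzero fractional part. *)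
have {}dT : d%:~R < T.
  rewrite lt_neqAle dT andbT; apply: contraNneq ne => <-.
  by rewrite -(cf_ext0 (rcons c d)) cf_ext_rcons addr0.
pose S := s * d%:~R + s'; pose f := T - d%:~R.
have f01 : 0 < f < 1 by rewrite /f; lra.
have f0 : 0 < f by lra.
have S0 : 0 < S by rewrite /S; nra.
have SQ : Q <= S by rewrite /S /Q; nra.
pose t' := (S * (S + s * f) / f / Q - q) / Q.
have t'E : Q * (Q * t' + q) = S * (S + s * f) / f.
  by rewrite /t'; field; rewrite !lt0r_neq0.
have red' : S * (S + s) < Q * (Q * t' + q).
  rewrite t'E ltr_pdivlMr //.
  have : 0 < S * S * (1 - f) by rewrite !mulr_gt0 //; lra.
  by nra.
have t'1 : 1 <= t' by nra.
exists t'.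
  split=> //.
  rewrite -alphaE' alphaE' (cf_ext_rcons_offset c d T) //.
  rewrite (cf_ext_offset (rcons b a) t') //; last by lra.
  rewrite !denoms_rcons /= -/q -/q' -/s -/s' -/Q -/S t'E size_rcons exprS sz.
  have -> : s * T + s' = S + s * f by rewrite /S /f; ring.
  have -> : d%:~R - T = - f by rewrite /f; ring.
  by field; rewrite !lt0r_neq0 //; nra.
right; rewrite /remainder_bounds !denoms_rcons -/q -/q' -/s -/s' -/Q -/S; split=> //.
(* T < d + 1 on the c side, and W / e = Q / e - q >= Q - q on the b side. *)
have : Q * W / e <= s * (S + s).
  by rewrite -TE ler_pM2l // /S; nra.
apply: le_trans; rewrite -mulrA ler_pM2l // ler_pdivlMr // QE; nra.
Qed.

(** b_{n+1} = floor t + 1 <= T - 1 < floor T = c_{n+1}. The bounds, with q <= s and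
    q' <= s', also force t > 1, so that floor t really is the partial quotient. *)
Lemma shulga_step_increasing {R : realType} (alpha : R) (b c b' c' : seq int) :
  shulga_invariant alpha b c -> shulga_step alpha (b, c) = Some (b', c') ->
  shulga_invariant alpha b' c' /\
  exists a d : int,
    [/\ b' = rcons b a, c' = rcons c d & b <> [::] -> a < d].
Proof.
move=> [sz bP cP [qs qs'] ex]; rewrite /shulga_step.
case: ifPn => // /ex[t [t1 alphaE] red].
have bt : b = [::] \/ 1 < t.
  case: red => [|red]; [by left | right].
  have [q1 q'0] := denoms_ge (R := R) _ bP; have [s1 s'0] := denoms_ge (R := R) _ cP.
  move: red; rewrite /remainder_bounds.
  move: (denoms b) (denoms c) q1 q'0 s1 s'0 qs qs' => [q q'] [s s'] /= *.
  nra.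
have [T [alphaE' T1 aT] inv] := shulga_round alpha t b c sz bP cP qs qs' t1 alphaE red.
rewrite {1}alphaE addrC addKr partial_quotient_ext //.
rewrite {1}alphaE' addrC addKr sz partial_quotient_ext //; [|exact: ltW|by right].
case=> <- <-; split=> //; exists (Num.floor t + 1), (Num.floor T); split=> // /aT.
by rewrite -[X in _ + X](mulr1z 1) -intrD -floor_ge_int lezD1.
Qed.

Lemma shulga_stateS {R : realType} (alpha : R) (n : nat) :
  shulga_state alpha n.+1 = obind (shulga_step alpha) (shulga_state alpha n).
Proof. by []. Qed.

Lemma shulga_state_invariant {R : realType} (alpha : R) (n : nat)
    (b c : seq int) :
  0 <= alpha <= 1 -> shulga_state alpha n = Some (b, c) ->
  shulga_invariant alpha b c /\ size b = n.
Proof.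
move=> alpha01; elim: n b c => [|n IH] b c.
  by case=> <- <-; split=> //; exact: shulga_invariant0.
rewrite shulga_stateS.
case E: (shulga_state alpha n) => [[b0 c0]|] // step.
have [inv sb] := IH _ _ E.
have [inv' [a [d [eb _ _]]]] := shulga_step_increasing _ _ _ _ _ inv step.
by split=> //; rewrite eb size_rcons sb.
Qed.

Theorem theorem4 (R : realType) (alpha : R) (alpha01 : 0 <= alpha <= 1)
    (n : nat) (bn cn : int) :
  (1 < n)%N ->
  shulga_b alpha n = Some bn ->
  shulga_c alpha n = Some cn ->
  bn < cn.
Proof.
case: n => [//|n] n0; rewrite /shulga_b /shulga_c.
case E: (shulga_state alpha n.+1) => [[b' c']|] //=.
move: E; rewrite shulga_stateS.
case E: (shulga_state alpha n) => [[b c]|] // step.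
have [inv sb] := shulga_state_invariant _ _ _ _ alpha01 E.
have sc : size c = n by case: inv => <-.
have [_ [a [d [-> -> lt_ad]]]] := shulga_step_increasing _ _ _ _ _ inv step.
rewrite -!cats1 !onth_cat sb sc ltnn subnn /= => -[<-] [<-].
by apply: lt_ad => b0; move: sb n0; rewrite b0 => <-.
Qed.
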